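(* Let $A,B\in\mathbb{R}^n\times\mathbb{R}_+$ be a couple of points, $A=(x_1,\dots,x_n,t_A)$ and $B=(y_1,\dots,y_n,t_B)$, and let $x_*,x^*$ denote the points of intersection, with the plane $\{(x,t)\mid x\in\mathbb{R}^n,\ t=0\}$, of the circle passing through $A$ and $B$, with center in $\{t=0\}$, and lying in the two-dimensional plane that contains $A$ and $B$ and is parallel to the $t$-axis. Furthermore, let $K(\vec{x},t;\vec{y})$ denote the Poisson kernel, i.e. $$K(\vec{x},t;\vec{y})=c_n\frac{t}{\left(t^2+|\vec{x}-\vec{y}|^2\right)^{\frac{n+1}{2}}},\qquad c_n=\frac{\Gamma\left(\frac{n+1}{2}\right)}{\pi^{\frac{n+1}{2}}}.$$ Then the following formula holds: $$\frac{D_{20}D_{13}}{D_{10}D_{23}}=\left(\frac{K(A,x_* )}{K(B,x_* )}\,\frac{K(B,x^* )}{K(A,x^* )}\right)^{\frac{1}{n+1}},$$ where $D_{ab}$ are the chords described by the expressions $$D_{20}=\sqrt{t_B^2+|B'-x_*|^2},\quad D_{13}=\sqrt{t_A^2+|A'-x^*|^2},\quad D_{10}=\sqrt{t_A^2+|A'-x_*|^2},\quad D_{23}=\sqrt{t_B^2+|B'-x^*|^2},$$ and $A'=(x_1,\dots,x_n,0)$, $B'=(y_1,\dots,y_n,0)$ are the projections of $A$ and $B$ onto $\{t=0\}$.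
   Context: Here $n$ is the number of spatial dimensions, $\mathbb{R}_+=(0,\infty)$, $|\cdot|$ is the Euclidean norm, and the plane $\{t=0\}$ is identified with $\mathbb{R}^n$, so that $A',B',x_*,x^*$ are also regarded as points of $\mathbb{R}^n$. $K$ is the Poisson kernel with a spatial shift; the Poisson kernel is the fundamental solution of the half-Laplacian heat equation $\partial_t u+(-\Delta)^{1/2}u=0$ in $n$ spatial dimensions. For $z\in\mathbb{R}^n$, $K(A,z)$ means $K(A',t_A;z)$ and $K(B,z)$ means $K(B',t_B;z)$. The center $O'$ of the circle is the point of $\{t=0\}$ that lies in the two-dimensional plane of the circle and is equidistant from $A$ and $B$; its radius is $r=|O'-A|=|O'-B|$ (distances in $\mathbb{R}^{n+1}$). The intersection points are labelled by $x_*=O'-r\frac{A'B'}{|A'B'|}$ and $x^*=O'+r\frac{A'B'}{|A'B'|}$, where $A'B'$ denotes the vector from $A'$ to $B'$. *)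

(* Defs.v *)
From HB Require Import structures.
From mathcomp Require Import all_boot all_order all_algebra.
From mathcomp Require Import all_classical all_reals all_analysis.
From mathcomp Require Import ring lra.

Set Implicit Arguments.
Unset Strict Implicit.
Unset Printing Implicit Defensive.

Import Order.TTheory GRing.Theory Num.Theory.
Import numFieldNormedType.Exports.

Local Open Scope classical_set_scope.
Local Open Scope ring_scope.

(* MathComp's canonical norm on 'rV[R]_n is the max norm, hence [eucl_norm]. *)
Definition eucl_norm (R : realType) (n : nat) (u : 'rV[R]_n) : R :=
  Num.sqrt (\sum_(i < n) u ord0 i ^+ 2).

(* A point (x, t) of R^n x R is a pair P, with P.1 = x and P.2 = t.  A point x
   of the plane {t = 0} is identified with x : 'rV[R]_n, so that the projection
   of P onto {t = 0} is P.1. *)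
Definition eucl_dist (R : realType) (n : nat) (P Q : 'rV[R]_n * R) : R :=
  Num.sqrt (eucl_norm (P.1 - Q.1) ^+ 2 + (P.2 - Q.2) ^+ 2).

Definition plane_t0 (R : realType) (n : nat) : set ('rV[R]_n * R) :=
  [set P | P.2 = 0].

(* The plane through A and B parallel to the t-axis; it is two-dimensional
   exactly when A.1 != B.1. *)
Definition vertical_plane (R : realType) (n : nat) (A B : 'rV[R]_n * R) :
    set ('rV[R]_n * R) :=
  [set P | exists s : R, P.1 = A.1 + s *: (B.1 - A.1)].

Definition is_center (R : realType) (n : nat) (A B : 'rV[R]_n * R)
    (O : 'rV[R]_n) : Prop :=
  vertical_plane A B (O, 0) /\ eucl_dist (O, 0) A = eucl_dist (O, 0) B.

Definition circle (R : realType) (n : nat) (A B : 'rV[R]_n * R)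
    (O : 'rV[R]_n) : set ('rV[R]_n * R) :=
  [set P | vertical_plane A B P /\ eucl_dist (O, 0) P = eucl_dist (O, 0) A].

Definition unit_dir (R : realType) (n : nat) (A B : 'rV[R]_n * R) : 'rV[R]_n :=
  (eucl_norm (B.1 - A.1))^-1 *: (B.1 - A.1).

(* Gamma(a) for a > 0, by Euler's integral. *)
Definition Gamma (R : realType) (a : R) : R :=
  \int[@lebesgue_measure R]_(x in `]0, +oo[) (x `^ (a - 1) * expR (- x)).

Definition poisson_const (R : realType) (n : nat) : R :=
  Gamma (n.+1%:R / 2) / pi `^ (n.+1%:R / 2).

Definition poisson_kernel (R : realType) (n : nat) (P : 'rV[R]_n * R)
    (y : 'rV[R]_n) : R :=
  poisson_const R n *
    (P.2 / (P.2 ^+ 2 + eucl_norm (P.1 - y) ^+ 2) `^ (n.+1%:R / 2)).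

Lemma eucl_norm_ge0 (R : realType) (n : nat) (u : 'rV[R]_n) : 0 <= eucl_norm u.
Proof. exact: sqrtr_ge0. Qed.

Lemma eucl_normZ (R : realType) (n : nat) (a : R) (u : 'rV[R]_n) :
  eucl_norm (a *: u) = `|a| * eucl_norm u.
Proof.
rewrite /eucl_norm -sqrtr_sqr -sqrtrM ?sqr_ge0// mulr_sumr; congr Num.sqrt.
by apply: eq_bigr => i _; rewrite mxE exprMn.
Qed.

Lemma eucl_norm_eq0 (R : realType) (n : nat) (u : 'rV[R]_n) :
  (eucl_norm u == 0) = (u == 0).
Proof.
apply/eqP/eqP => [|->]; last first.
  by rewrite -(scale0r 0) eucl_normZ normr0 mul0r.
move=> /eqP; rewrite sqrtr_eq0 => h; apply/rowP => i; rewrite mxE.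
have sq0 j : true -> 0 <= u ord0 j ^+ 2 by rewrite sqr_ge0.
have /eqP : \sum_(j < n) u ord0 j ^+ 2 = 0.
  by apply/eqP; rewrite eq_le h sumr_ge0.
rewrite psumr_eq0// => /allP/(_ i (mem_index_enum _)).
by rewrite sqrf_eq0 => /eqP.
Qed.

Lemma eucl_norm_gt0 (R : realType) (n : nat) (A B : 'rV[R]_n * R) :
  A.1 != B.1 -> 0 < eucl_norm (B.1 - A.1).
Proof.
by move=> AB; rewrite lt_def eucl_norm_ge0 eucl_norm_eq0 subr_eq0 eq_sym AB.
Qed.

Lemma eucl_normN (R : realType) (n : nat) (u : 'rV[R]_n) :
  eucl_norm (- u) = eucl_norm u.
Proof. by rewrite -scaleN1r eucl_normZ normrN1 mul1r. Qed.

Lemma is_centerP (R : realType) (n : nat) (A B : 'rV[R]_n * R) (O : 'rV[R]_n) :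
  A.1 != B.1 ->
  is_center A B O <->
  O = A.1 + ((eucl_norm (B.1 - A.1) ^+ 2 + B.2 ^+ 2 - A.2 ^+ 2)
              / (2 * eucl_norm (B.1 - A.1) ^+ 2)) *: (B.1 - A.1).
Proof.
move=> AB; have v0 := eucl_norm_gt0 AB.
set v := B.1 - A.1 in v0 *; set L := eucl_norm v in v0 *.
have key s : eucl_dist (A.1 + s *: v, 0) A = eucl_dist (A.1 + s *: v, 0) B <->
    s = (L ^+ 2 + B.2 ^+ 2 - A.2 ^+ 2) / (2 * L ^+ 2).
  have -> : eucl_dist (A.1 + s *: v, 0) A =
      Num.sqrt (s ^+ 2 * L ^+ 2 + A.2 ^+ 2).
    rewrite /eucl_dist /= (addrAC A.1) subrr add0r eucl_normZ.
    rewrite exprMn real_normK ?num_real//.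
    by rewrite sub0r sqrrN.
  have -> : eucl_dist (A.1 + s *: v, 0) B =
      Num.sqrt ((s - 1) ^+ 2 * L ^+ 2 + B.2 ^+ 2).
    have E : A.1 + s *: v - B.1 = (s - 1) *: v.
      by rewrite scalerBl scale1r /v opprB addrA (addrC A.1).
    rewrite /eucl_dist /= E.
    by rewrite eucl_normZ exprMn real_normK ?num_real// sub0r sqrrN.
  split=> [/eqP|->]; last by congr Num.sqrt; field; rewrite gt_eqF.
  have ge0 a c : 0 <= a ^+ 2 * L ^+ 2 + c ^+ 2.
    by rewrite addr_ge0 ?sqr_ge0// -exprMn sqr_ge0.
  rewrite eqr_sqrt ?ge0// => /eqP h.
  apply: (@mulIf _ (2 * L ^+ 2)).
    by rewrite mulf_neq0 ?expf_neq0 ?gt_eqF.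
  rewrite divfK; last by rewrite mulf_neq0 ?expf_neq0 ?gt_eqF.
  by move: h; lra.
split=> [[[s /= ->]]|->].
  by move=> /key ->.
by split; [eexists; reflexivity | apply/key].
Qed.

(* The labelling of the two intersection points of the circle with {t = 0}. *)
Lemma circle_plane_t0 (R : realType) (n : nat) (A B : 'rV[R]_n * R)
    (O : 'rV[R]_n) : A.1 != B.1 -> is_center A B O ->
  circle A B O `&` plane_t0 (R := R) (n := n) =
  [set (O - eucl_dist (O, 0) A *: unit_dir A B, 0);
       (O + eucl_dist (O, 0) A *: unit_dir A B, 0)].
Proof.
move=> AB [[s /= Os] _]; have v0 := eucl_norm_gt0 AB.
set r := eucl_dist _ A; have r0 : 0 <= r by exact: sqrtr_ge0.
have dist0 x : eucl_dist (O, 0) (x, 0) = eucl_norm (x - O).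
  rewrite /eucl_dist /= subrr expr0n addr0 sqrtr_sqr ger0_norm ?eucl_norm_ge0//.
  by rewrite -opprB eucl_normN.
apply/seteqP; split=> [[x t] [[[s' /= xs'] hr] /= t0]|[x t]].
  rewrite /plane_t0 /= in t0; subst t.
  rewrite dist0 -/r in hr.
  have xO : x - O = (s' - s) *: (B.1 - A.1).
    by rewrite xs' Os opprD addrACA subrr add0r -scalerBl.
  have xE : x = O + ((s' - s) * eucl_norm (B.1 - A.1)) *: unit_dir A B.
    rewrite /unit_dir scalerA mulfK ?gt_eqF// -xO.
    by rewrite addrC subrK.
  move: hr; rewrite xO eucl_normZ.
  rewrite -[X in _ * X](ger0_norm (eucl_norm_ge0 _)) -normrM.
  set c := _ * _ in xE *; rewrite xE => hr.
  have [c0|c0] := leP 0 c.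
    by right; rewrite -hr ger0_norm.
  by left; rewrite -hr ltr0_norm// scaleNr opprK.
have u1 : eucl_norm (unit_dir A B) = 1.
  by rewrite /unit_dir eucl_normZ gtr0_norm ?invr_gt0// mulVf ?gt_eqF.
have inv c : vertical_plane A B (O + c *: unit_dir A B, 0).
  exists (s + c / eucl_norm (B.1 - A.1)) => /=.
  by rewrite Os /unit_dir scalerA scalerDl addrA.
case=> -[-> ->]; split=> //; split.
- by rewrite -scaleNr.
- by rewrite dist0 addrAC subrr add0r eucl_normN eucl_normZ u1 mulr1 ger0_norm.
- by [].
- by rewrite dist0 addrAC subrr add0r eucl_normZ u1 mulr1 ger0_norm.
Qed.

(* Main.v *)
Require Import Defs.
From mathcomp Require Import all_boot all_order all_algebra.
From mathcomp Require Import all_classical all_reals all_analysis.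
From mathcomp Require Import measurable_realfun ring lra.

Import Order.TTheory GRing.Theory Num.Theory.
Import numFieldNormedType.Exports.

Local Open Scope classical_set_scope.
Local Open Scope ring_scope.

(** Since [(t ^+ 2 + |x - y| ^+ 2) `^ ((n + 1) / 2)] is the [(n + 1)]-st power
    of the distance from [(x, t)] to [(y, 0)], the kernel is
    [K (x, t) y = c_n * t / dist ^+ (n + 1)] (lemma [poisson_kernelE]).  In the
    product [(K A y / K B y) * (K B z / K A z)] the constants [c_n] and the
    heights [t_A], [t_B] all cancel, which leaves the [(n + 1)]-st power of the
    cross-ratio of the four chords; its [(n + 1)]-st root is the cross-ratio
    itself (lemma [chord_cross_ratio]).

    Cancelling [c_n] takes [c_n != 0], that is [Gamma ((n + 1) / 2) != 0].  A
    divergent integral would have the real value [0], so this asks for two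
    things: that Euler's integral converges, and that it is positive.  The
    exponent of the integrand [x `^ (a - 1) * expR (- x)] is nonnegative here,
    because two points with distinct projections only exist when [0 < n].  The
    integrand is then dominated by a multiple of the density of an exponential
    distribution, and it is at least [expR (- 2)] on [[1, 2]]. *)

(** [b * ln x] grows more slowly than [x / 2]: with [c = 2 * b + 1], the tangent
    line of [ln] at [c] gives [ln x <= x / c + ln c], and [b / c <= 1 / 2]. *)
Lemma powR_le_expR_half {R : realType} {b x : R} : 0 <= b -> 0 < x ->
  x `^ b <= (2 * b + 1) `^ b * expR (x / 2).
Proof.
move=> b0 x0; have c0 : 0 < 2 * b + 1 by lra.
rewrite /powR !gt_eqF// -expRD ler_expR.
have -> : ln x = ln (x / (2 * b + 1)) + ln (2 * b + 1).
  by rewrite -lnM ?posrE ?divr_gt0// divfK ?gt_eqF.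
have /ltW h : ln (x / (2 * b + 1)) < x / (2 * b + 1).
  by rewrite ln_sublinear ?divr_gt0.
rewrite mulrDr addrC lerD2l (le_trans (ler_wpM2l b0 h))//.
by rewrite mulrCA ler_pM2l// ler_pdivrMr// mulrC; lra.
Qed.

Lemma measurable_Gamma_integrand {R : realType} (a : R) :
  measurable_fun [set: R] (fun x : R => x `^ (a - 1) * expR (- x)).
Proof.
apply: measurable_funM; first exact: measurable_powR.
by apply: measurableT_comp; [exact: measurable_expR|exact: measurable_funN].
Qed.

Lemma integrable_Gamma_integrand {R : realType} {a : R} : 1 <= a ->
  (@lebesgue_measure R).-integrable `]0, +oo[
    (fun x : R => (x `^ (a - 1) * expR (- x))%:E).
Proof.
move=> a1; have a10 : 0 <= a - 1 by rewrite subr_ge0.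
(* [expR (- x / 2)] is twice the exponential density of rate [1 / 2]. *)
pose C : R := (2 * (a - 1) + 1) `^ (a - 1) * 2.
have intg : (@lebesgue_measure R).-integrable `]0, +oo[
    (fun x => C%:E * (exponential_pdf (2^-1 : R) x)%:E)%E.
  apply: integrableZl => //.
  apply: (@integrableS _ _ _ _ setT) => //.
  by apply: integrable_exponential_pdf; rewrite invr_gt0.
apply: le_integrable intg => //.
- by apply/measurable_EFinP; apply: measurable_funTS;
    exact: measurable_Gamma_integrand.
- move=> x /=; rewrite in_itv/= andbT => x0.
  rewrite lee_fin exponential_pdfE ?invr_ge0 ?(ltW x0)//.
  rewrite !ger0_norm ?mulr_ge0 ?powR_ge0 ?expR_ge0 ?invr_ge0//.
  rewrite /C -mulrA (mulrA 2) divff ?pnatr_eq0// mul1r.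
  rewrite (_ : - x = x / - 2 + - (x / 2)); last by field.
  rewrite (le_trans (ler_wpM2r (expR_ge0 _) (powR_le_expR_half a10 x0)))//.
  rewrite -mulrA -expRD; apply: ler_wpM2l; first exact: powR_ge0.
  by rewrite ler_expR; lra.
Qed.

Lemma Gamma_gt0 {R : realType} {a : R} : 1 <= a -> 0 < Gamma a.
Proof.
move=> a1; have a10 : 0 <= a - 1 by rewrite subr_ge0.
have f0 (x : R) : 0 <= x `^ (a - 1) * expR (- x).
  by rewrite mulr_ge0 ?powR_ge0 ?expR_ge0.
have mf (D : set R) : measurable_fun D
    (fun x : R => (x `^ (a - 1) * expR (- x))%:E).
  by apply/measurable_EFinP; apply: measurable_funTS;
    exact: measurable_Gamma_integrand.
apply: fine_gt0; apply/andP; split; last first.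
  rewrite ltey_eq; apply/orP; left.
  exact: integrable_fin_num (integrable_Gamma_integrand a1).
apply: (@lt_le_trans _ _ (\int[@lebesgue_measure R]_(x in `[1%R, 2%R])
    (expR (- 2))%:E)%E).
  rewrite integral_cst//= lebesgue_measure_itv/= lte_fin ltr1n.
  by rewrite -EFinD lte_fin mulr_gt0 ?expR_gt0//; lra.
apply: (@le_trans _ _ (\int[@lebesgue_measure R]_(x in `[1%R, 2%R])
    (x `^ (a - 1) * expR (- x))%:E)%E).
  apply: ge0_le_integral => //.
    exact: mf.
  move=> x /=; rewrite in_itv/= => /andP[x1 x2].
  rewrite lee_fin -[leLHS]mul1r ler_pM ?expR_ge0//; 
    last by rewrite ler_expR lerN2.
  by rewrite -[leLHS](powRr0 x) ler_powR.
apply: ge0_subset_integral => //; first exact: mf.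
  by move=> x _; rewrite lee_fin.
move=> x /=; rewrite !in_itv/= andbT => /andP[x1 _].
exact: lt_le_trans x1.
Qed.

Lemma poisson_const_gt0 (R : realType) (n : nat) : (0 < n)%N ->
  0 < poisson_const R n.
Proof.
move=> n0; rewrite divr_gt0 ?powR_gt0 ?pi_gt0// Gamma_gt0//.
by rewrite ler_pdivlMr// mul1r ler_nat.
Qed.

Definition chord {R : realType} {n : nat} (P : 'rV[R]_n * R) (y : 'rV[R]_n) : R :=
  Num.sqrt (P.2 ^+ 2 + eucl_norm (P.1 - y) ^+ 2).

Lemma chord_gt0 {R : realType} {n : nat} {P : 'rV[R]_n * R} (y : 'rV[R]_n) :
  0 < P.2 -> 0 < chord P y.
Proof. by move=> t0; rewrite sqrtr_gt0 ltr_pwDl ?exprn_gt0 ?sqr_ge0. Qed.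

Lemma poisson_kernelE {R : realType} {n : nat} (P : 'rV[R]_n * R)
    (y : 'rV[R]_n) :
  poisson_kernel P y = poisson_const R n * (P.2 / chord P y ^+ n.+1).
Proof.
have d0 : 0 <= P.2 ^+ 2 + eucl_norm (P.1 - y) ^+ 2 by rewrite addr_ge0 ?sqr_ge0.
rewrite /poisson_kernel mulrC [n.+1%:R / 2]mulrC powRrM powR12_sqrt//.
by rewrite powR_mulrn ?sqrtr_ge0 1?mulrC.
Qed.

Lemma chord_cross_ratio {R : realType} {n : nat} (A B : 'rV[R]_n * R)
    (y z : 'rV[R]_n) : (0 < n)%N -> 0 < A.2 -> 0 < B.2 ->
  (chord B y * chord A z) / (chord A y * chord B z) =
  ((poisson_kernel A y / poisson_kernel B y) *
   (poisson_kernel B z / poisson_kernel A z)) `^ (n.+1%:R^-1).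
Proof.
move=> n0 A0 B0.
have c0 := poisson_const_gt0 R _ n0.
have dAy := chord_gt0 y A0; have dBy := chord_gt0 y B0.
have dAz := chord_gt0 z A0; have dBz := chord_gt0 z B0.
rewrite !poisson_kernelE.
set x := LHS; have x0 : 0 <= x by rewrite ltW// divr_gt0 ?mulr_gt0.
rewrite [X in X `^ _](_ : _ = x ^+ n.+1).
  by rewrite -powR_mulrn// -powRrM divff ?pnatr_eq0// powRr1.
rewrite /x expr_div_n !exprMn.
by field; rewrite ?expf_neq0 ?gt_eqF.
Qed.

Theorem theorem3p1 (R : realType) (n : nat) (A B : 'rV[R]_n * R)
    (O x_lo x_up : 'rV[R]_n)
    (tA_gt0 : 0 < A.2) (tB_gt0 : 0 < B.2) (A'_neq_B' : A.1 != B.1)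
    (O_center : is_center A B O)
    (x_inter : circle A B O `&` @plane_t0 R n = [set (x_lo, 0); (x_up, 0)])
    (x_loE : x_lo = O - eucl_dist (O, 0) A *: unit_dir A B)
    (x_upE : x_up = O + eucl_dist (O, 0) A *: unit_dir A B) :
  let K := @poisson_kernel R n in
  let D20 := Num.sqrt (B.2 ^+ 2 + eucl_norm (B.1 - x_lo) ^+ 2) in
  let D13 := Num.sqrt (A.2 ^+ 2 + eucl_norm (A.1 - x_up) ^+ 2) in
  let D10 := Num.sqrt (A.2 ^+ 2 + eucl_norm (A.1 - x_lo) ^+ 2) in
  let D23 := Num.sqrt (B.2 ^+ 2 + eucl_norm (B.1 - x_up) ^+ 2) in
  (D20 * D13) / (D10 * D23) =
  ((K A x_lo / K B x_lo) * (K B x_up / K A x_up)) `^ (n.+1%:R^-1).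
Proof.
apply: chord_cross_ratio => //.
(* In dimension 0 the projections of [A] and [B] coincide. *)
rewrite lt0n; apply: contraNneq A'_neq_B' => n0.
by apply/eqP/rowP => -[i i_lt]; exfalso; rewrite n0 in i_lt.
Qed.
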